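(* Let $r \geq 2$ be an integer, and let $S_{C_4}^r$ be the generalized Sierpi\'nski graph of dimension $r$ over the $4$-cycle $C_4$. Then the following hold. (i) $\dim(S_{C_4}^r) = \dim_E(S_{C_4}^r) = \frac{4}{3}\left(2+4^{r-2}\right)$. (ii) $\dim'(S_{C_4}^r) = \dim'_E(S_{C_4}^r) = \frac{8}{3}\left(2+4^{r-2}\right)$.
   Context: All graphs are finite, simple and undirected. Generalized Sierpi\'nski graphs. Let $G$ be a graph and $r \ge 1$ an integer. The generalized Sierpi\'nski graph $S_G^r$ has vertex set $V(G)^r$, whose elements are written as strings $x = x_r x_{r-1}\ldots x_1$ with each $x_i \in V(G)$. Two vertices $x = x_r\ldots x_1$ and $y = y_r \ldots y_1$ are adjacent if and only if there is an index $t \in \{1,\ldots,r\}$ such that: (a) $x_i = y_i$ for all $i > t$; (b) $x_t \neq y_t$ and $x_t y_t \in E(G)$; (c) $x_i = y_t$ and $y_i = x_t$ for all $i < t$. Here $C_4$ is the cycle with vertex set $\{0,1,2,3\}$ and edges $01, 12, 23, 30$. Distances. For a connected graph $G$, $d_G(u,v)$ is the number of edges on a shortest $u,v$-path. For a vertex $u$ and an edge $e = vw$, $d_G(u,e) = \min\{d_G(u,v), d_G(u,w)\}$. Metric generators. A set $X \subseteq V(G)$ is a metric generator of $G$ if for every two distinct vertices $x,y \in V(G)$ there is $u \in X$ with $d_G(u,x) \ne d_G(u,y)$. The metric dimension $\dim(G)$ is the minimum cardinality of a metric generator. A set $F \subseteq V(G)$ is a fault-tolerant metric generator if $F$ is a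 metric generator and $F \setminus \{u\}$ is a metric generator for every $u \in F$; $\dim'(G)$ is the minimum cardinality of a fault-tolerant metric generator. Edge metric generators. A set $S \subseteq V(G)$ is an edge metric generator of $G$ if for every two distinct edges $e,f \in E(G)$ there is $w \in S$ with $d_G(w,e) \ne d_G(w,f)$. The edge metric dimension $\dim_E(G)$ is the minimum cardinality of an edge metric generator. A set $F \subseteq V(G)$ is a fault-tolerant edge metric generator if $F$ is an edge metric generator and $F \setminus \{u\}$ is an edge metric generator for every $u \in F$; $\dim'_E(G)$ is the minimum cardinality of a fault-tolerant edge metric generator. *)

(* Defs.v *)
From HB Require Import structures.
From mathcomp Require Import all_boot all_order all_algebra.
Set Implicit Arguments.
Unset Strict Implicit.
Unset Printing Implicit Defensive.

Record sgraph := SGraph {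
  vertex :> finType;
  adj : rel vertex;
  adj_sym : symmetric adj;
  adj_irr : irreflexive adj }.

Section Sierpinski.
Variables (G : sgraph) (r : nat).

(* A string x_r ... x_1 is the function i |-> x_(i+1), so the ordinal i stands
   for the position i+1 and the order on positions is preserved. *)
Definition sierp_adj : rel {ffun 'I_r -> G} := fun x y =>
  [exists t : 'I_r,
    [&& [forall i : 'I_r, (t < i) ==> (x i == y i)],
        (x t != y t) && adj (x t) (y t) &
        [forall i : 'I_r, (i < t) ==> (x i == y t) && (y i == x t)]]].

Lemma sierp_adj_sym : symmetric sierp_adj.
Proof.
suff H x y : sierp_adj x y -> sierp_adj y x by move=> x y; apply/idP/idP => /H.
case/existsP=> t /and3P[/forallP hi /andP[ne e] /forallP lo].
apply/existsP; exists t; rewrite eq_sym ne adj_sym e /=; apply/andP; split.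
  by apply/forallP=> i; rewrite eq_sym; apply: hi.
by apply/forallP=> i; rewrite andbC; apply: lo.
Qed.

Lemma sierp_adj_irr : irreflexive sierp_adj.
Proof. by move=> x; apply/existsP=> -[t]; rewrite eqxx andbF. Qed.

Definition sierpinski : sgraph := SGraph sierp_adj_sym sierp_adj_irr.

End Sierpinski.

Definition cycle4_adj : rel 'I_4 := fun i j =>
  (j == i.+1 %% 4 :> nat) || (i == j.+1 %% 4 :> nat).

Lemma cycle4_adj_sym : symmetric cycle4_adj.
Proof. by move=> i j; rewrite /cycle4_adj orbC. Qed.

Lemma cycle4_adj_irr : irreflexive cycle4_adj.
Proof. by move=> [[|[|[|[|i]]]] //]. Qed.

Definition C4 : sgraph := SGraph cycle4_adj_sym cycle4_adj_irr.

Section Dimensions.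
Variable G : sgraph.
Implicit Types (u v w : G) (S F : {set G}).

Definition has_path u v (n : nat) : bool :=
  [exists p : n.-tuple G,
    [&& path (@adj G) u p, uniq (u :: p) & last u p == v]].

(* The index found is the least n with has_path u v n: a path has fewer than
   #|G| edges.  If v is not reachable from u, the value is #|G|. *)
Definition dist u v : nat := find (has_path u v) (iota 0 #|G|).

(* Distance from u to the edge vw. *)
Definition edist u v w : nat := minn (dist u v) (dist u w).

Definition metric_gen S : bool :=
  [forall x : G, forall y : G,
    (x != y) ==> [exists u in S, dist u x != dist u y]].

(* Edges are given by their endpoints; two edges are distinct when their
   unordered pairs of endpoints are. *)
Definition edge_metric_gen S : bool :=
  [forall v : G, forall w : G, forall v' : G, forall w' : G,
    [&& adj v w, adj v' w' & [set v; w] != [set v'; w']] ==>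
    [exists u in S, edist u v w != edist u v' w']].

Definition fault_tolerant (P : pred {set G}) F : bool :=
  P F && [forall u in F, P (F :\ u)].

(* This is the minimum as soon as setT satisfies P, which is proved below for
   the four predicates used (metric_genT, edge_metric_genT, ft_metric_genT and
   ft_edge_metric_genT). *)
Definition min_card (P : pred {set G}) : nat :=
  #|[arg min_(S < [set: G] | P S) #|S| ]|.

Lemma min_cardP (P : pred {set G}) : P setT ->
  (exists2 S, P S & #|S| = min_card P) /\ (forall S, P S -> min_card P <= #|S|).
Proof.
move=> PT; rewrite /min_card.
by case: arg_minnP => // S PS minS; split; [exists S|].
Qed.

Definition mdim : nat := min_card metric_gen.
Definition edim : nat := min_card edge_metric_gen.
Definition ft_mdim : nat := min_card (fault_tolerant metric_gen).
Definition ft_edim : nat := min_card (fault_tolerant edge_metric_gen).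

Lemma dist_eq0 u v : (dist u v == 0) = (u == v).
Proof.
have h0 : has_path u v 0 = (u == v).
  apply/existsP/idP => [[p]|uv]; first by rewrite (tuple0 p).
  by exists [tuple].
have : 0 < #|G| by apply/card_gt0P; exists u.
by rewrite /dist; case: #|G| => //= n _; rewrite h0; case: (u == v).
Qed.

Lemma edist_eq0 u v w : (edist u v w == 0) = (u \in [set v; w]).
Proof.
rewrite !inE -!dist_eq0 /edist -!leqn0.
by rewrite geq_min.
Qed.

Lemma cosingle_mem S u v : #|~: S| <= 1 -> u != v -> (u \in S) || (v \in S).
Proof.
move=> /card_le1_eqP S1; apply: contraR; rewrite negb_or => /andP[uS vS].
by apply/eqP/S1; rewrite inE.
Qed.

Lemma metric_gen_cosingle S : #|~: S| <= 1 -> metric_gen S.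
Proof.
move=> S1; apply/forallP=> x; apply/forallP=> y; apply/implyP=> nxy.
apply/existsP; case/orP: (cosingle_mem S1 nxy) => inS; [exists x|exists y].
  by rewrite inS; apply: contra nxy => /eqP e; rewrite -dist_eq0 -e dist_eq0.
rewrite inS; apply: contra nxy => /eqP e.
by rewrite eq_sym -dist_eq0 e dist_eq0.
Qed.

Lemma edge_metric_gen_cosingle S : #|~: S| <= 1 -> edge_metric_gen S.
Proof.
move=> S1; apply/forallP=> v; apply/forallP=> w; apply/forallP=> v'.
apply/forallP=> w'; apply/implyP=> /and3P[e e' ne].
have card2 (a b : G) : adj a b -> #|[set a; b]| = 2.
  by move=> ab; rewrite cards2; case: eqVneq ab => // ->; rewrite adj_irr.
have /subsetPn[a ain aout] : ~~ ([set v; w] \subset [set v'; w']).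
  by apply: contra ne => sub; rewrite eqEcard sub !card2.
have /subsetPn[b bin bout] : ~~ ([set v'; w'] \subset [set v; w]).
  by apply: contra ne => sub; rewrite eq_sym eqEcard sub !card2.
have nab : a != b by apply: contraNneq aout => ->.
apply/existsP; case/orP: (cosingle_mem S1 nab) => inS; [exists a|exists b].
  by rewrite inS; apply: contra aout => /eqP E; rewrite -edist_eq0 -E edist_eq0.
by rewrite inS; apply: contra bout => /eqP E; rewrite -edist_eq0 E edist_eq0.
Qed.

Lemma fault_tolerantT (P : pred {set G}) :
  (forall S, #|~: S| <= 1 -> P S) -> fault_tolerant P setT.
Proof.
move=> PS; apply/andP; split; first by rewrite PS // setCT cards0.
apply/forall_inP=> u _; apply: PS.
by rewrite setTD setCK cards1.
Qed.

Lemma metric_genT : metric_gen setT.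
Proof. by apply: metric_gen_cosingle; rewrite setCT cards0. Qed.

Lemma edge_metric_genT : edge_metric_gen setT.
Proof. by apply: edge_metric_gen_cosingle; rewrite setCT cards0. Qed.

Lemma ft_metric_genT : fault_tolerant metric_gen setT.
Proof. exact: fault_tolerantT metric_gen_cosingle. Qed.

Lemma ft_edge_metric_genT : fault_tolerant edge_metric_gen setT.
Proof. exact: fault_tolerantT edge_metric_gen_cosingle. Qed.

End Dimensions.

(* Main.v *)
Require Import Defs.
From mathcomp Require Import all_boot all_order all_algebra.
From mathcomp Require Import zify.
Set Implicit Arguments.
Unset Strict Implicit.
Unset Printing Implicit Defensive.

(** Every value is governed by pairs of twins, that is, of distinct vertices
    with the same neighbours.

    Lower bounds.  Exchanging two twins x and y is an automorphism fixing every
    other vertex, so only x and y themselves tell x from y, or the edge vx from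
    the edge vy at a common neighbour v.  Hence a (vertex or edge) metric
    generator meets every pair of twins, and a fault-tolerant one, which has to
    meet the pair after the loss of either element, contains both.  In the
    Sierpinski graph over C4, opposite vertices x and [mirror x] of one of the
    smallest 4-cycles are twins exactly when none of the two carries an edge
    leaving that cycle ([is_twin]); the pairs are disjoint.

    Upper bounds.  Conversely, every set F that meets all these pairs
    distinguishes vertices and distinguishes edges (lemma [resolve]).  So one
    element of each pair is optimal for both dimensions, and the set of all
    twins is optimal for both fault-tolerant ones, because deleting one vertex
    from it still leaves a vertex of each pair.  The values are therefore the
    number N of pairs and 2 N.  Removing the lowest digit gives a recursion for
    N, whose solution is 3 N = 8 + 4 ^ (r - 1) (lemma [card_reps]).

    Why F resolves.  The graph on n + 1 digits is a ring of four copies of the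
    graph on n digits, where copy i is joined to an adjacent copy j by an edge
    from the corner jj...j of copy i to the corner ii...i of copy j.  This
    yields a closed recursive formula [sdist] for distances ([distE]), with the
    corners of a copy at mutual distance 2 ^ n - 1 or 2 ^ n.+1 - 2.  The proof
    is by induction on n, for vertices and edges at once, a vertex being
    regarded as an edge with equal ends ([cell]).  In each copy i the set F has
    an element l_i at the corner ii...i or at the mirror of that corner
    ([near_corner]), and
    - if one cell lies in copy k and the other does not, they have different
      distances to the landmark in the copy opposite to k ([separate_copies]);
    - if both cells are edges between copies, joining different pairs of copies,
      then some landmark l_i lies in a copy touched by only one of them
      ([bridge_copy]);
    - if both cells lie in the same copy k, the induction hypothesis applies to
      that copy: the two corners through which copy k is left may have lost
      their twins, but the landmarks of the adjacent copies reach copy k through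
      exactly these corners, so that the corners act as virtual landmarks. *)

(** * Walks and distances *)

Section Walks.
Variable G : sgraph.
Implicit Types (u v w : G) (S : {set G}).

Definition walk u v n :=
  exists p, [/\ path (@adj G) u p, last u p = v & size p = n].

Lemma walk_refl u : walk u u 0. Proof. by exists [::]. Qed.

Lemma walk_edge u v : adj u v -> walk u v 1.
Proof. by move=> uv; exists [:: v]; rewrite /= uv. Qed.

Lemma walk_trans v u w a b : walk u v a -> walk v w b -> walk u w (a + b).
Proof.
move=> [p [pp lp <-]] [q [pq lq <-]]; exists (p ++ q).
by rewrite cat_path last_cat size_cat lp pp pq lq.
Qed.

Lemma walk_sym u v n : walk u v n -> walk v u n.
Proof.
move=> [p [pp lp <-]]; exists (rev (belast u p)).
split; last by rewrite size_rev size_belast.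
  by rewrite -lp rev_path; apply: sub_path pp => x y; rewrite adj_sym.
by case: p {pp} lp => [|x p] //= _; rewrite rev_cons last_rcons.
Qed.

(** A candidate formula is recognised as the distance without constructing
    shortest paths: the Lipschitz condition bounds the length of any path from
    below, and the walk bounds the distance from above. *)
Lemma dist_unique (d : G -> G -> nat) :
  (forall u, d u u = 0) ->
  (forall u v w, adj v w -> d u w <= (d u v).+1) ->
  (forall u v, walk u v (d u v)) ->
  forall u v, dist u v = d u v.
Proof.
move=> d0 dL dW u v.
have low p w : path (@adj G) w p ->
    forall k, d u w <= k -> d u (last w p) <= k + size p.
  elim: p w => [|x p IH] w /=; first by move=> _ k; rewrite addn0.
  case/andP=> wx /IH{}IH k ku; rewrite -addSnnS; apply: IH.
  exact: leq_trans (dL _ _ _ wx) _.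
have lowP n : has_path u v n -> d u v <= n.
  case/existsP=> p /and3P[pp _ /eqP <-].
  by have := low _ _ pp 0; rewrite d0 size_tuple; apply.
have [hp lt] : has_path u v (d u v) /\ d u v < #|G|.
  have [p [pp lp sp]] := dW u v.
  (* a shortened walk is not shorter, by the Lipschitz bound *)
  move: lp; case/shortenP: pp => q pq uq sub lp.
  have sq : size q = d u v.
    apply/eqP; rewrite eqn_leq; apply/andP; split.
      rewrite -sp; have := uniq_leq_size _ sub; apply.
      by case/andP: uq.
    by have := low _ _ pq 0; rewrite d0 lp; apply.
  rewrite -sq; split.
    by apply/existsP; exists (in_tuple q); rewrite [uniq _]uq /= pq lp eqxx.
  by rewrite -[(size q).+1]/(size (u :: q)) -(card_uniqP uq) max_card.
rewrite /dist.
have hs : has (has_path u v) (iota 0 #|G|).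
  by apply/hasP; exists (d u v) => //; rewrite mem_iota.
have fl : find (has_path u v) (iota 0 #|G|) < #|G|.
  by rewrite -[X in _ < X](size_iota 0) -has_find.
apply/eqP; rewrite eqn_leq; apply/andP; split.
  rewrite leqNgt; apply/negP=> /(before_find 0).
  by rewrite nth_iota // add0n hp.
by apply: lowP; have := nth_find 0 hs; rewrite nth_iota.
Qed.

Lemma dist_auto (s : G -> G) : injective s ->
  (forall x y, adj (s x) (s y) = adj x y) ->
  forall u v, dist (s u) (s v) = dist u v.
Proof.
move=> sI sA.
suff H (f : G -> G) u v n : injective f ->
    (forall x y, adj (f x) (f y) = adj x y) ->
    has_path u v n -> has_path (f u) (f v) n.
  move=> u v; apply: eq_find => n; apply/idP/idP; last exact: H.
  have [t sK tK] := injF_bij sI.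
  rewrite -[u in X in _ -> X]sK -[v in X in _ -> X]sK; apply: H.
    exact: can_inj tK.
  by move=> x y; rewrite -{2}[x]tK -{2}[y]tK sA.
move=> fI fA /existsP[p /and3P[pp up /eqP lp]].
apply/existsP; exists (map_tuple f p); rewrite /= last_map lp eqxx andbT.
rewrite path_map -[_ && _]/(_ && uniq (map f (u :: p))) map_inj_uniq // up andbT.
by rewrite (eq_path (e' := @adj G)).
Qed.

(** * Twins are met by every generator *)

Definition twins x y := x != y /\ forall w, adj x w = adj y w.

(** The exchange of x and y is an automorphism fixing w. *)
Lemma dist_twins x y w : twins x y -> w != x -> w != y -> dist w x = dist w y.
Proof.
move=> [nxy xy] wx wy.
pose s z := if z == x then y else if z == y then x else z.
have sw : s w = w by rewrite /s (negPf wx) (negPf wy).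
have sx : s x = y by rewrite /s eqxx.
have sK : involutive s.
  move=> z; rewrite /s; case: (eqVneq z x) => [->|zx].
    by rewrite eq_sym (negPf nxy) eqxx.
  by case: (eqVneq z y) => [->|zy]; rewrite ?eqxx // (negPf zx) (negPf zy).
have sL z t : adj (s z) t = adj z t.
  rewrite /s; case: (eqVneq z x) => [->//|zx].
  by case: (eqVneq z y) => [->//|zy].
rewrite -{1}sw -{1}[x]sK sx dist_auto //; first exact: inv_inj.
by move=> z t; rewrite sL adj_sym sL adj_sym.
Qed.

Lemma metric_gen_twins S x y : twins x y -> metric_gen S ->
  (x \in S) || (y \in S).
Proof.
move=> tw /forallP/(_ x)/forallP/(_ y)/implyP/(_ (proj1 tw)).
case/existsP=> w /andP[wS]; apply: contraNT; rewrite negb_or => /andP[xS yS].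
by apply/eqP/dist_twins => //; apply: contraTneq wS => ->.
Qed.

(** The edges vx and vy are the ones that only x and y distinguish. *)
Lemma edge_metric_gen_twins S x y v : twins x y -> adj v x ->
  edge_metric_gen S -> (x \in S) || (y \in S).
Proof.
move=> tw vx /forallP/(_ v)/forallP/(_ x)/forallP/(_ v)/forallP/(_ y)/implyP.
have [nxy xy] := tw.
have vy : adj v y by rewrite adj_sym -xy adj_sym.
have ne : [set v; x] != [set v; y].
  apply: contraNneq nxy => /setP/(_ x); rewrite !inE eqxx orbT => /esym.
  by case/orP=> // /eqP xv; rewrite xv adj_irr in vx.
rewrite vx vy ne => /(_ isT) /existsP[w /andP[wS]].
apply: contraNT; rewrite negb_or => /andP[xS yS].
by rewrite /edist (dist_twins tw) //; apply: contraTneq wS => ->.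
Qed.

End Walks.

Lemma min_card_eq (G : sgraph) (P : pred {set G}) n : P setT ->
  (exists2 S, P S & #|S| = n) -> (forall S, P S -> n <= #|S|) -> min_card P = n.
Proof.
move=> PT [S PS <-] low; have [[S' PS' mS] min] := min_cardP PT.
by apply/eqP; rewrite eqn_leq min // -mS low.
Qed.

(** * The 4-cycle *)

Local Notation c4 := cycle4_adj.

Section FourCycle.
Implicit Types i j k : 'I_4.

Definition antipode i : 'I_4 := inord ((i + 2) %% 4).

(** The neighbour chosen depends only on the parity of i, so antipodal vertices
    get the same one. *)
Definition neighbor i : 'I_4 := if odd i then inord 0 else inord 1.

(** C4 is the complete bipartite graph K_{2,2}, with parity as the two sides. *)
Lemma c4E i j : c4 i j = (odd i != odd j).
Proof. by case: i j => [[|[|[|[|i]]]] hi] // [[|[|[|[|j]]]] hj]. Qed.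

Lemma c4_sym i j : c4 i j = c4 j i. Proof. exact: cycle4_adj_sym. Qed.

Lemma c4_irr i j : c4 i j -> i != j.
Proof. by apply: contraTneq => ->; rewrite cycle4_adj_irr. Qed.

Lemma odd_antipode i : odd (antipode i) = odd i.
Proof. by case: i => [[|[|[|[|i]]]] hi] //; rewrite /antipode inordK. Qed.

Lemma antipodeK : involutive antipode.
Proof.
by case=> [[|[|[|[|i]]]] hi] //; apply/val_inj; rewrite /antipode /= !inordK.
Qed.

Lemma antipode_neq i : (antipode i == i) = false.
Proof.
by case: i => [[|[|[|[|i]]]] hi] //; rewrite -val_eqE /antipode /= inordK.
Qed.

Lemma c4_antipoder i j : c4 i (antipode j) = c4 i j.
Proof. by rewrite !c4E odd_antipode. Qed.

Lemma c4_antipodel i j : c4 (antipode i) j = c4 i j.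
Proof. by rewrite c4_sym c4_antipoder c4_sym. Qed.

Lemma c4_neighbor i : c4 i (neighbor i).
Proof. by rewrite c4E /neighbor; case: (odd i); rewrite inordK. Qed.

Lemma odd_eq i j : odd i = odd j -> j = i \/ j = antipode i.
Proof.
by case: i j => [[|[|[|[|i]]]] hi] // [[|[|[|[|j]]]] hj] // _;
  [left|right|left|right|right|left|right|left];
  apply/val_inj; rewrite /antipode /= ?inordK.
Qed.

Lemma c4_cases i j k : c4 i j -> c4 i k -> k = j \/ k = antipode j.
Proof.
by rewrite !c4E => ij ik; apply: odd_eq; case: odd ij ik; do 2![case: odd].
Qed.

Lemma c4_trichotomy i j : [\/ i = j, c4 i j | j = antipode i].
Proof.
case: (boolP (c4 i j)) => [|]; first by constructor 2.
rewrite c4E negbK => /eqP/odd_eq [->|]; first by constructor 1.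
by constructor 3.
Qed.

Definition c4dist i j := if i == j then 0 else if c4 i j then 1 else 2.

(** Distance and reflexive adjacency on plain numbers, where the finite check
    [c4_resolve_nat] can be evaluated. *)
Let D (p q : nat) := if p == q then 0 else if odd p != odd q then 1 else 2.
Let cellb (p q : nat) := (p == q) || (odd p != odd q).

Lemma c4_resolve_nat : all (fun a => all (fun b => all (fun p => all (fun q =>
  all (fun p' => all (fun q' =>
   [&& odd a != odd b, cellb p q, cellb p' q', (p == q) == (p' == q'),
    minn (D a p) (D a q) == minn (D a p') (D a q') &
    minn (D b p) (D b q) == minn (D b p') (D b q')] ==>
   ((p == p') && (q == q')) || ((p == q') && (q == p')))
  (iota 0 4)) (iota 0 4)) (iota 0 4)) (iota 0 4)) (iota 0 4)) (iota 0 4).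
Proof. by vm_compute. Qed.

(** The base case of the main induction, by inspection.  A pair with p = q stands
    for a vertex, a pair of adjacent p and q for an edge. *)
Lemma c4_resolve (a b p q p' q' : 'I_4) : c4 a b ->
  p = q \/ c4 p q -> p' = q' \/ c4 p' q' -> (p == q) = (p' == q') ->
  minn (c4dist a p) (c4dist a q) = minn (c4dist a p') (c4dist a q') ->
  minn (c4dist b p) (c4dist b q) = minn (c4dist b p') (c4dist b q') ->
  (p = p' /\ q = q') \/ (p = q' /\ q = p').
Proof.
move=> ab c c' k ea eb.
have M (i : 'I_4) : val i \in iota 0 4 by rewrite mem_iota ltn_ord.
have := c4_resolve_nat.
move=> /allP/(_ _ (M a))/allP/(_ _ (M b))/allP/(_ _ (M p))/allP/(_ _ (M q)).
move=> /allP/(_ _ (M p'))/allP/(_ _ (M q'))/implyP.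
have DE i j : D (val i) (val j) = c4dist i j by rewrite /D /c4dist c4E.
rewrite !DE -c4E ab ea eb !eqxx !val_eqE k eqxx /cellb -!c4E !val_eqE.
have -> : (p == q) || c4 p q by case: c => ->; rewrite ?eqxx ?orbT.
have -> : (p' == q') || c4 p' q' by case: c' => ->; rewrite ?eqxx ?orbT.
by move=> /(_ isT)/orP[]/andP[/eqP-> /eqP->]; [left|right].
Qed.

End FourCycle.

Lemma pow2_gt0 n : 0 < 2 ^ n. Proof. by rewrite expn_gt0. Qed.

(** * Distances in the Sierpinski graph over C4 *)

Section Sierpinski.
Variable m : nat.
Local Notation r := m.+1.
Local Notation word := {ffun 'I_r -> C4}.
Implicit Types (u v w x y z : word) (j b : 'I_4).

(** Digits are indexed by plain numbers, so that inductions on the number n of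
    low digits considered stay inside the fixed type of words. *)
Definition digit x k : 'I_4 := x (inord k).
Definition constw j : word := [ffun=> j].

Definition agree_below n x y := forall k, k < n -> digit x k = digit y k.
Definition agree_from n x y := forall k, n <= k < r -> digit x k = digit y k.

Lemma digit_constw j k : digit (constw j) k = j.
Proof. by rewrite /digit ffunE. Qed.

Lemma word_ext x y : (forall k, k < r -> digit x k = digit y k) -> x = y.
Proof.
by move=> E; apply/ffunP=> i; have := E i (ltn_ord i); rewrite /digit inord_val.
Qed.

Lemma agree_fromC n x z : agree_from n x z -> agree_from n z x.
Proof. by move=> E k /E. Qed.

Lemma agree_fromT n x y z :
  agree_from n x y -> agree_from n y z -> agree_from n x z.
Proof. by move=> E F k h; rewrite E // F. Qed.

Lemma agree_fromS n x z : agree_from n x z -> agree_from n.+1 x z.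
Proof. by move=> E k /andP[nk kr]; apply: E; rewrite ltnW. Qed.

Lemma agree_from_pred n x z :
  digit x n = digit z n -> agree_from n.+1 x z -> agree_from n x z.
Proof.
move=> e E k; rewrite leq_eqVlt => /andP[/orP[/eqP <- //|nk kr]].
by apply: E; rewrite nk.
Qed.

(** Adjacency through the index t of the definition of the graph. *)
Definition level t x y :=
  [/\ forall k, t < k < r -> digit x k = digit y k,
      c4 (digit x t) (digit y t) &
      forall k, k < t -> digit x k = digit y t /\ digit y k = digit x t].

Lemma adjP x y : reflect (exists2 t, t < r & level t x y)
  (adj (x : sierpinski C4 r) y).
Proof.
apply: (iffP existsP) => [[t /and3P[/forallP hi /andP[_ e] /forallP lo]]|].
  exists t => //; split=> [k /andP[tk kr]| |k kt].
  - by have /implyP := hi (inord k); rewrite inordK // => /(_ tk) /eqP.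
  - by rewrite /digit inord_val.
  have kr : k < r by apply: ltn_trans kt (ltn_ord t).
  have /implyP := lo (inord k); rewrite inordK // => /(_ kt).
  by case/andP=> /eqP a /eqP b; rewrite /digit inord_val a b.
case=> t tr [hi e lo]; exists (inord t).
rewrite -[x (inord t)]/(digit x t) -[y (inord t)]/(digit y t).
rewrite (c4_irr e) [adj _ _]e /= inordK //; apply/andP; split.
  apply/forallP=> i; apply/implyP=> ti; have := hi i; rewrite ti ltn_ord.
  by rewrite /digit inord_val => ->.
apply/forallP=> i; apply/implyP=> /lo; rewrite /digit inord_val => -[-> ->].
by rewrite !eqxx.
Qed.

(** The distance between the words formed by the n lowest digits of x and y.
    Between adjacent copies a and b the shortest path crosses the edge joining
    them; between opposite copies it passes through one of the two copies in
    between, at a cost of 2 edges and the 2 ^ k.+1 - 2 steps from one corner of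
    that copy to the opposite one. *)
Fixpoint sdist n x y :=
  if n is k.+1 then
    let a := digit x k in let b := digit y k in
    let via j := sdist k x (constw j) + sdist k y (constw j) in
    if a == b then sdist k x y
    else if c4 a b then (sdist k x (constw b) + sdist k y (constw a)).+1
    else minn (via (neighbor a)) (via (antipode (neighbor a))) + 2 ^ k.+1
  else 0.

Lemma sdist_same n x y : digit x n = digit y n -> sdist n.+1 x y = sdist n x y.
Proof. by move=> /= ->; rewrite eqxx. Qed.

Lemma sdist_adj n x y : c4 (digit x n) (digit y n) -> sdist n.+1 x y =
  (sdist n x (constw (digit y n)) + sdist n y (constw (digit x n))).+1.
Proof. by move=> /= e; rewrite (negPf (c4_irr e)) e. Qed.

Lemma sdist_opp j n x y :
  digit y n = antipode (digit x n) -> c4 (digit x n) j -> sdist n.+1 x y =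
  minn (sdist n x (constw j) + sdist n y (constw j))
       (sdist n x (constw (antipode j)) + sdist n y (constw (antipode j)))
  + 2 ^ n.+1.
Proof.
move=> /= -> xj; rewrite eq_sym antipode_neq c4_antipoder cycle4_adj_irr.
congr (_ + _); case: (c4_cases (c4_neighbor (digit x n)) xj) => -> //.
by rewrite antipodeK minnC.
Qed.

Lemma sdistxx n x : sdist n x x = 0.
Proof. by elim: n => //= n IH; rewrite eqxx. Qed.

Lemma sdist1 u v : sdist 1 u v = c4dist (digit u 0) (digit v 0).
Proof. by []. Qed.

Lemma sdistC n x y : sdist n x y = sdist n y x.
Proof.
elim: n x y => // n IH x y.
case: (c4_trichotomy (digit x n) (digit y n)) => e.
- by rewrite !sdist_same.
- by rewrite !sdist_adj // 1?c4_sym // addnC.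
have xn := c4_neighbor (digit x n).
rewrite (sdist_opp e xn) (@sdist_opp (neighbor (digit x n))).
- by rewrite ![sdist n y _ + _]addnC.
- by rewrite e antipodeK.
by rewrite e c4_antipodel.
Qed.

Lemma sdist_congl n x x' y : agree_below n x x' -> sdist n x y = sdist n x' y.
Proof.
elim: n x x' y => // n IH x x' y E /=.
have E' : agree_below n x x' by move=> k kn; apply: E; apply: ltnW.
by rewrite E // !(IH x x').
Qed.

Lemma sdist_congr n x y y' : agree_below n y y' -> sdist n x y = sdist n x y'.
Proof. by move=> E; rewrite ![sdist n x _]sdistC; apply: sdist_congl. Qed.

Lemma sdist_corner n i j : c4 i j -> sdist n (constw i) (constw j) = 2 ^ n - 1.
Proof.
elim: n i j => // n IH i j ij; rewrite sdist_adj !digit_constw //.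
have := pow2_gt0 n; rewrite [sdist n (constw j) _]sdistC !IH // expnS; lia.
Qed.

Lemma sdist_corner_opp n i :
  sdist n (constw i) (constw (antipode i)) = 2 ^ n.+1 - 2.
Proof.
case: n => // n; have inb := c4_neighbor i.
rewrite (@sdist_opp (neighbor i)) ?digit_constw //.
rewrite !sdist_corner ?c4_antipoder ?c4_antipodel //.
by have := pow2_gt0 n; rewrite minnn !expnS; lia.
Qed.

Lemma sdist_constw_adj n x b : c4 (digit x n) b ->
  sdist n.+1 x (constw b) = sdist n x (constw b) + 2 ^ n.
Proof.
move=> e; rewrite sdist_adj digit_constw // sdist_corner; last by rewrite c4_sym.
by have := pow2_gt0 n; lia.
Qed.

Lemma sdist_constw_opp n x b j : b = antipode (digit x n) -> c4 (digit x n) j ->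
  sdist n.+1 x (constw b) =
    minn (sdist n x (constw j)) (sdist n x (constw (antipode j)))
    + (3 * 2 ^ n - 1).
Proof.
move=> e xj; rewrite (@sdist_opp j) ?digit_constw // e.
rewrite !sdist_corner ?c4_antipodel ?c4_antipoder //.
by have := pow2_gt0 n; rewrite expnS; lia.
Qed.

(** The bound on the eccentricity of a corner in the opposite case needs that
    every word is close to one of any two opposite corners, whence the joint
    induction. *)
Lemma ecc_corner n x :
  (forall b, sdist n x (constw b) <= 2 ^ n.+1 - 2) /\
  (forall b, minn (sdist n x (constw b)) (sdist n x (constw (antipode b)))
             <= 2 ^ n - 1).
Proof.
elim: n => [|n [IH1 IH2]]; first by split.
have P := pow2_gt0 n; split=> b.
  case: (c4_trichotomy (digit x n) b) => e.
  - by rewrite sdist_same ?digit_constw //; have := IH1 b; rewrite !expnS; lia.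
  - by rewrite sdist_constw_adj //; have := IH1 b; rewrite !expnS; lia.
  rewrite (sdist_constw_opp e (c4_neighbor _)).
  by have := IH2 (neighbor (digit x n)); rewrite !expnS; lia.
case: (c4_trichotomy (digit x n) b) => e.
- rewrite [X in minn X]sdist_same ?digit_constw //.
  by have := IH1 b; rewrite !expnS; lia.
- by rewrite !sdist_constw_adj ?c4_antipoder //; have := IH2 b; rewrite !expnS; lia.
rewrite [X in minn _ X]sdist_same; last by rewrite e digit_constw antipodeK.
by have := IH1 (antipode b); rewrite !expnS; lia.
Qed.

(** Only the top level t = n of an adjacency needs an argument: there x and y
    are the corners at the two ends of an edge between copies, so all their
    distances are known. *)
Lemma sdist_lip n t u x y : n <= r -> t < n -> level t x y ->
  sdist n u x <= (sdist n u y).+1 /\ sdist n u y <= (sdist n u x).+1.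
Proof.
move=> + + L; elim: n u => // n IH u nr.
rewrite ltnS leq_eqVlt => /orP[/eqP tn|tn].
  case: L => _; rewrite tn => xy lo.
  set i := digit x n; set j := digit y n in xy lo *.
  have Ex : agree_below n x (constw j) by move=> k /lo[->]; rewrite digit_constw.
  have Ey : agree_below n y (constw i) by move=> k /lo[_ ->]; rewrite digit_constw.
  have P := pow2_gt0 n.
  have S (a b : 'I_4) (p q : word) : c4 a b -> digit p n = a -> digit q n = b ->
      agree_below n p (constw b) -> agree_below n q (constw a) ->
      digit u n = a \/ digit u n = antipode a ->
      sdist n.+1 u p <= (sdist n.+1 u q).+1 /\
      sdist n.+1 u q <= (sdist n.+1 u p).+1.
    move=> ab pa qb Ep Eq [ua|ua].
      rewrite sdist_same ?ua // sdist_adj ?ua ?qb // (sdist_congr _ Ep).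
      by rewrite (sdist_congl _ Eq) sdistxx; lia.
    have [/(_ b) B _] := ecc_corner n u.
    rewrite (@sdist_opp b) ?pa ?ua ?antipodeK ?c4_antipodel //.
    rewrite sdist_adj ?ua ?qb ?c4_antipodel //.
    rewrite (sdist_congl _ Eq) sdist_corner_opp !(sdist_congl _ Ep) sdistxx.
    by rewrite sdist_corner_opp !expnS in B *; lia.
  case: (c4_trichotomy i (digit u n)) => [e|e|e].
  - by apply: (S i j) => //; left.
  - have := c4_cases xy e => e'.
    by case: (S j i y x) => //; rewrite 1?c4_sym //; case: e'; auto.
  - by apply: (S i j) => //; right.
have {IH} H v := IH v (ltnW nr) tn.
have E : digit x n = digit y n by case: L => h _ _; apply: h; rewrite tn.
rewrite /= E; case: ifP => _; first exact: H.
have H' j := H (constw j).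
have := H' (digit u n); rewrite ![sdist n (constw (digit u n)) _]sdistC.
case: ifP => _; first by lia.
set j := neighbor _.
have := H' j; have := H' (antipode j).
rewrite ![sdist n (constw (antipode j)) _]sdistC ![sdist n (constw j) _]sdistC.
lia.
Qed.

(** The word of the same copy as x whose n lowest digits are j: a corner of that
    copy. *)
Definition fill n j x : word := [ffun i : 'I_r => if i < n then j else x i].

Lemma digit_fill n j x k : k < r ->
  digit (fill n j x) k = if k < n then j else digit x k.
Proof. by move=> kr; rewrite /digit /fill ffunE inordK. Qed.

Lemma fill_below n j x : n <= r -> agree_below n (fill n j x) (constw j).
Proof.
by move=> nr k kn; rewrite digit_fill ?kn ?digit_constw //; apply: leq_trans nr.
Qed.

Lemma fill_from n j x : agree_from n (fill n j x) x.
Proof. by move=> k /andP[nk kr]; rewrite digit_fill // ltnNge nk. Qed.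

Local Notation wk := (@walk (sierpinski C4 r)).

Lemma walk_sdist n x y : n <= r -> agree_from n x y -> wk x y (sdist n x y).
Proof.
elim: n x y => [|n IH] x y nr E.
  suff -> : x = y by apply: walk_refl.
  by apply: word_ext.
have nr' := ltnW nr.
have cw a (z : word) : wk z (fill n a z) (sdist n z (constw a)).
  rewrite -(sdist_congr _ (fill_below a z nr')); apply: IH => // k kn.
  by rewrite fill_from.
have W p q : c4 (digit p n) (digit q n) -> agree_from n.+1 p q ->
    wk p q (sdist n p (constw (digit q n)) + sdist n q (constw (digit p n))).+1.
  move=> e E'; rewrite -addnS; apply: walk_trans (cw _ _) _.
  rewrite -(add1n (sdist n q _)); apply: walk_trans (walk_sym (cw _ _)).
  apply: walk_edge; apply/adjP; exists n => //; split=> [k /andP[nk kr]| |k kn].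
  - by rewrite !digit_fill // ltnNge (ltnW nk) /= E' ?nk.
  - by rewrite !digit_fill // ltnn.
  by rewrite !digit_fill // ?kn ?ltnn //; apply: ltn_trans nr.
case: (c4_trichotomy (digit x n) (digit y n)) => e.
- by rewrite sdist_same //; apply: IH => //; apply: agree_from_pred.
- by rewrite sdist_adj //; apply: W.
have xj := c4_neighbor (digit x n); set j := neighbor _ in xj *.
rewrite (sdist_opp e xj).
suff H i : c4 (digit x n) i ->
    wk x y (sdist n x (constw i) + sdist n y (constw i) + 2 ^ n.+1).
  by case: leqP => _; apply: H; rewrite ?c4_antipoder.
move=> xi.
(* z is the corner through which copy i is entered from the copy of x *)
pose z : word := [ffun k : 'I_r =>
  if k < n then digit x n else if k == n :> nat then i else x k].
have dz k : k < r ->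
    digit z k = if k < n then digit x n else if k == n then i else digit x k.
  by move=> kr; rewrite /digit /z ffunE inordK.
have zn : digit z n = i by rewrite dz // ltnn eqxx.
have zb : agree_below n z (constw (digit x n)).
  by move=> k kn; rewrite dz ?kn ?digit_constw //; apply: ltn_trans nr.
have zf : agree_from n.+1 z x.
  by move=> k /andP[nk kr]; rewrite dz // ltnNge (ltnW nk) /= gtn_eqF.
have := W x z; rewrite zn => /(_ xi) w1.
have := W z y; rewrite zn e c4_antipoder c4_sym => /(_ xi) w2.
have := walk_trans (w1 (agree_fromC zf)) (w2 (agree_fromT zf E)).
rewrite !(sdist_congl _ zb) sdistxx sdist_corner_opp.
have -> : (sdist n x (constw i) + 0).+1
   + (2 ^ n.+1 - 2 + sdist n y (constw i)).+1
   = sdist n x (constw i) + sdist n y (constw i) + 2 ^ n.+1.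
  by have := pow2_gt0 n; rewrite expnS; lia.
by [].
Qed.

Theorem distE (x y : sierpinski C4 r) : dist x y = sdist r x y.
Proof.
apply: (@dist_unique (sierpinski C4 r) (sdist r)) => [u|u v w /adjP[t tr L]|u v].
- exact: sdistxx.
- by have [] := sdist_lip u (leqnn r) tr L.
apply: walk_sdist => [|k /andP[rk]]; [exact: leqnn|by rewrite ltnNge rk].
Qed.

(** * The twins of the graph *)

Definition mirror x : word :=
  [ffun i : 'I_r => if i == 0 :> nat then antipode (x i) else x i].

Lemma digit_mirror0 x : digit (mirror x) 0 = antipode (digit x 0).
Proof. by rewrite /digit /mirror ffunE inordK. Qed.

Lemma digit_mirror x k : 0 < k < r -> digit (mirror x) k = digit x k.
Proof. by case/andP=> k0 kr; rewrite /digit /mirror ffunE inordK // gtn_eqF. Qed.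

Lemma mirrorK : involutive mirror.
Proof.
move=> x; apply: word_ext => -[|k] kr; first by rewrite !digit_mirror0 antipodeK.
by rewrite !digit_mirror.
Qed.

Lemma mirror_agree_from n x z :
  0 < n -> agree_from n x z -> agree_from n (mirror x) z.
Proof.
move=> n0 xz k /andP[nk kr]; rewrite digit_mirror ?xz ?nk //.
by rewrite kr (leq_trans n0).
Qed.

(** No edge at x or at its mirror has a level t with 0 < t < n.  The digits from
    1 to t - 1 are all compared with digit 1, and digit 0 is only constrained up
    to its antipode, which makes the condition invariant under [mirror]; for
    t = 1 it says that digits 0 and 1 are equal or antipodal. *)
Definition is_twin n x := [forall t : 'I_n, (0 < t) ==>
  [forall i : 'I_t, (0 < i) ==> (digit x i == digit x 1)] ==>
  ~~ c4 (digit x t) (digit x 0)].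

Lemma is_twinP n x : reflect
  (forall t, 0 < t < n -> (forall i, 0 < i < t -> digit x i = digit x 1) ->
     ~~ c4 (digit x t) (digit x 0)) (is_twin n x).
Proof.
apply: (iffP forallP) => [H t /andP[t0 tn] h|H t].
  have /implyP/(_ t0)/implyP := H (Ordinal tn); apply.
  by apply/forallP=> i; apply/implyP=> i0; apply/eqP/h; rewrite i0 /=.
apply/implyP=> t0; apply/implyP=> /forallP h; apply: H => [|i /andP[i0 it]].
  by rewrite t0 /=.
by have /implyP/(_ i0)/eqP := h (Ordinal it).
Qed.

Lemma is_twin_mirror n x : n <= r -> is_twin n (mirror x) = is_twin n x.
Proof.
move=> nr; suff H y : is_twin n y -> is_twin n (mirror y).
  by apply/idP/idP => /H; rewrite ?mirrorK.
move/is_twinP=> h; apply/is_twinP=> t /andP[t0 tn] e.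
have tr := leq_trans tn nr.
rewrite digit_mirror0 c4_antipoder digit_mirror ?t0 //.
apply: h; rewrite ?t0 // => i /andP[i0 it].
have := e i; rewrite !digit_mirror ?i0 ?it /=; [apply=> // | | exact: ltn_trans tr].
exact: leq_ltn_trans tr.
Qed.

Lemma is_twin_twins x :
  is_twin r x -> twins (x : sierpinski C4 r) (mirror x).
Proof.
have H (y w : sierpinski C4 r) : is_twin r y -> adj y w ->
      adj (mirror y : sierpinski C4 r) w.
  move=> /is_twinP fy /adjP[[|t] tr [hi e lo]].
    apply/adjP; exists 0 => //; split=> // [k /andP[k0 kr]|].
      by rewrite digit_mirror ?k0 //; apply: hi; rewrite k0.
    by rewrite digit_mirror0 c4_antipodel.
  have := fy t.+1; rewrite tr => /(_ isT); rewrite (lo 0 _).1 // e => h.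
  suff : ~~ true by [].
  by apply: h => -[|i] // /andP[_ it]; rewrite (lo i.+1 _).1 // (lo 1 _).1 //; lia.
move=> fx; split.
  apply/eqP=> /(congr1 (fun y => digit y 0)); rewrite digit_mirror0 => /esym/eqP.
  by rewrite antipode_neq.
move=> w; apply/idP/idP; first exact: H.
by move/H; rewrite mirrorK is_twin_mirror // => ->.
Qed.

Lemma has_neighbor (x : sierpinski C4 r) : exists v : sierpinski C4 r, adj v x.
Proof.
exists [ffun i : 'I_r => if i == 0 :> nat then neighbor (digit x 0) else x i].
rewrite adj_sym; apply/adjP; exists 0 => //; split=> // [k /andP[k0 kr]|].
  by rewrite /digit ffunE inordK // gtn_eqF.
by rewrite {2}/digit ffunE inordK //= c4_neighbor.
Qed.

(** * Landmarks near corners *)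

(** The n lowest digits of x form the corner b or its mirror: two words with the
    same distances to every other word of the copy. *)
Definition near_corner n b x :=
  (forall k, 0 < k < n -> digit x k = b) /\ ~~ c4 b (digit x 0).

Lemma near_corner_pred k b u : near_corner k.+2 b u -> near_corner k.+1 b u.
Proof. by move=> [E E0]; split=> // i /andP[i0 ik]; apply: E; rewrite i0 ltnW. Qed.

Lemma near_corner_top k b u : near_corner k.+2 b u -> digit u k.+1 = b.
Proof. by case=> E _; apply: E; rewrite ltnS leqnn. Qed.

Lemma near_corner_gate n b u j : near_corner n.+1 b u -> c4 b j ->
  sdist n.+1 u (constw j) = 2 ^ n.+1 - 1.
Proof.
move=> + bj; elim: n => [|n IH] N.
  case: N => _ E0; rewrite sdist_adj ?digit_constw //; move: bj E0; rewrite !c4E.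
  by case: odd; case: odd; case: odd.
have P := pow2_gt0 n.
rewrite sdist_constw_adj ?(near_corner_top N) // (IH (near_corner_pred N)).
by rewrite !expnS; lia.
Qed.

Lemma near_corner_ecc n b u x :
  near_corner n.+1 b u -> sdist n.+1 u x <= 2 ^ n.+2 - 2.
Proof.
elim: n => [|n IH] N.
  by rewrite sdist1 /c4dist; case: ifP => // _; case: ifP.
have N' := near_corner_pred N; have En := near_corner_top N.
have P := pow2_gt0 n; have [B1 B2] := ecc_corner n.+1 x.
case: (c4_trichotomy (digit u n.+1) (digit x n.+1)) => e.
- by rewrite sdist_same //; have := IH N'; rewrite !expnS; lia.
- rewrite sdist_adj // En (near_corner_gate N') -?En //.
  by have := B1 (digit u n.+1); rewrite !expnS; lia.
rewrite En in e; rewrite (@sdist_opp (neighbor b)) ?En ?c4_neighbor //.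
rewrite !(near_corner_gate N') ?c4_antipoder ?c4_neighbor //.
by have := B2 (neighbor b); rewrite !expnS; lia.
Qed.

(** The distances from the landmark of copy b to the words of copy b, of the
    copies adjacent to b and of the copy opposite to b lie in three intervals,
    the last of which is disjoint from the two others. *)
Lemma near_corner_same k b u x : near_corner k.+2 b u -> digit x k.+1 = b ->
  sdist k.+2 u x <= 2 ^ k.+2 - 2.
Proof.
move=> N xb; rewrite sdist_same ?xb ?(near_corner_top N) //.
exact: near_corner_ecc (near_corner_pred N).
Qed.

Lemma near_corner_adj k b u x : near_corner k.+2 b u -> c4 b (digit x k.+1) ->
  sdist k.+2 u x = 2 ^ k.+1 + sdist k.+1 x (constw b).
Proof.
move=> N xb; rewrite sdist_adj ?(near_corner_top N) //.
rewrite (near_corner_gate (near_corner_pred N)) //.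
by have := pow2_gt0 k.+1; lia.
Qed.

Lemma near_corner_opp k b u x : near_corner k.+2 b u ->
  digit x k.+1 = antipode b -> 3 * 2 ^ k.+1 - 1 <= sdist k.+2 u x.
Proof.
move=> N xb; have N' := near_corner_pred N.
rewrite (@sdist_opp (neighbor b)) ?(near_corner_top N) // ?c4_neighbor //.
rewrite !(near_corner_gate N') ?c4_antipoder ?c4_neighbor //.
by have := pow2_gt0 k; rewrite !expnS; lia.
Qed.

Lemma near_corner_notopp k b u x : near_corner k.+2 b u ->
  digit x k.+1 != antipode b -> sdist k.+2 u x <= 3 * 2 ^ k.+1 - 2.
Proof.
move=> N; have P := pow2_gt0 k; case: (c4_trichotomy b (digit x k.+1)) => [e|e|->].
- by move=> _; have := near_corner_same N (esym e); rewrite !expnS; lia.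
- move=> _; rewrite (near_corner_adj N e).
  by have [/(_ b)] := ecc_corner k.+1 x; rewrite !expnS; lia.
by rewrite eqxx.
Qed.

Lemma near_corner_other k b u x : near_corner k.+2 b u -> digit x k.+1 != b ->
  2 ^ k.+1 <= sdist k.+2 u x.
Proof.
move=> N; have P := pow2_gt0 k; case: (c4_trichotomy b (digit x k.+1)) => [->|e|e].
- by rewrite eqxx.
- by move=> _; rewrite (near_corner_adj N e) leq_addr.
by move=> _; have := near_corner_opp N e; lia.
Qed.

(** * Sets meeting all pairs of twins resolve vertices and edges *)

Definition cell v w := v = w \/ exists2 t, t < r & level t v w.

Definition mdist n u v w := minn (sdist n u v) (sdist n u w).

(** [hits_from n z X]: X meets all pairs that are twins inside the graph formed
    by the words with the digits of z from n upwards. *)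
Definition hits_from n z (X : word -> Prop) :=
  forall x, agree_from n x z -> is_twin n x -> X x \/ X (mirror x).

Definition same_mdist n z (X : word -> Prop) v w v' w' :=
  forall u, X u -> agree_from n u z -> mdist n u v w = mdist n u v' w'.

Lemma cell_top n v w : n < r -> agree_from n.+1 v w -> cell v w ->
  digit v n = digit w n \/
  [/\ c4 (digit v n) (digit w n), agree_below n v (constw (digit w n)) &
      agree_below n w (constw (digit v n))].
Proof.
move=> nr E [->|[t tr L]]; first by left.
have : t < n.+1.
  case: L => _ e _; rewrite ltnNge; apply: contraL e => nt.
  by rewrite E ?nt // cycle4_adj_irr.
rewrite ltnS leq_eqVlt => /orP[/eqP tn|tn].
  right; case: L => _; rewrite tn => a b.
  by split=> // k /b[]; rewrite digit_constw.
by left; case: L => a _ _; apply: a; rewrite tn.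
Qed.

(** On one digit every word is a twin, so X contains two adjacent vertices of
    the 4-cycle. *)
Lemma resolve1 z X v w v' w' : hits_from 1 z X ->
  agree_from 1 v z -> agree_from 1 w z ->
  agree_from 1 v' z -> agree_from 1 w' z ->
  cell v w -> cell v' w' -> (v == w) = (v' == w') ->
  same_mdist 1 z X v w v' w' -> [set v; w] = [set v'; w'].
Proof.
move=> hX vz wz vz' wz' c c' k E.
have one x y : agree_from 1 x z -> agree_from 1 y z -> digit x 0 = digit y 0 ->
    x = y.
  by move=> a b e; apply: word_ext => -[|i] // ir; rewrite a // b.
have L a : exists u, [/\ X u, agree_from 1 u z &
    digit u 0 = a \/ digit u 0 = antipode a].
  have d0 : digit (fill 1 a z) 0 = a by rewrite digit_fill.
  have f : is_twin 1 (fill 1 a z) by apply/is_twinP=> t; case: t.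
  have az := @fill_from 1 a z.
  have [h|h] := hX _ az f; [exists (fill 1 a z)|exists (mirror (fill 1 a z))].
    by split=> //; left.
  by split=> //; [apply: mirror_agree_from|rewrite digit_mirror0 d0; right].
have [a [Xa aza da]] := L (inord 0); have [b [Xb bzb db]] := L (inord 1).
have ab : c4 (digit a 0) (digit b 0).
  by rewrite c4E; case: da db => -> [] ->; rewrite ?odd_antipode ?inordK.
have eq0 x y : agree_from 1 x z -> agree_from 1 y z ->
    (digit x 0 == digit y 0) = (x == y).
  by move=> xz yz; apply/eqP/eqP=> [|-> //]; apply: one.
have ct x y : agree_from 1 x z -> agree_from 1 y z -> cell x y ->
    digit x 0 = digit y 0 \/ c4 (digit x 0) (digit y 0).
  move=> xz yz /cell_top h; case: (h 0) => //; [|by left|by case; right].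
  exact: agree_fromT (agree_fromC yz).
have := c4_resolve ab (ct _ _ vz wz c) (ct _ _ vz' wz' c').
rewrite !eq0 // => /(_ k).
have := E _ Xa aza; have := E _ Xb bzb; rewrite /mdist !sdist1 => eb ea /(_ ea eb).
by case=> -[/one -> // /one ->] //; rewrite setUC.
Qed.

Section InductionStep.
Variables (n : nat) (z : word) (X : word -> Prop).
Hypotheses (nr : n.+1 < r) (hX : hits_from n.+2 z X).

Let top x := digit x n.+1.

Lemma landmark b :
  exists u, [/\ X u, agree_from n.+2 u z & near_corner n.+2 b u].
Proof.
set x := fill n.+2 b z; have xz : agree_from n.+2 x z by apply: fill_from.
have dx i : i < n.+2 -> digit x i = b.
  by move=> i2; rewrite digit_fill ?i2 //; apply: leq_trans nr.
have f : is_twin n.+2 x.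
  by apply/is_twinP=> t /andP[t0 tn] _; rewrite !dx // cycle4_adj_irr.
have [h|h] := hX xz f; [exists x|exists (mirror x)]; split=> //.
- by split=> [i /andP[_ /dx]|] //; rewrite dx // cycle4_adj_irr.
- exact: mirror_agree_from.
split=> [i /andP[i0 i2]|]; last first.
  by rewrite digit_mirror0 dx // c4_antipoder cycle4_adj_irr.
by rewrite digit_mirror ?i0 ?dx //=; apply: leq_trans nr.
Qed.

(** The landmark opposite to the copy of the second cell is farther from that
    copy than from any other word. *)
Lemma separate_copies v1 w1 v2 w2 : same_mdist n.+2 z X v1 w1 v2 w2 ->
  top v2 = top w2 -> top v1 = top v2 /\ top w1 = top v2.
Proof.
move=> H e; have [u [Xu uz N]] := landmark (antipode (top v2)).
have := H u Xu uz; rewrite /mdist; have P := pow2_gt0 n.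
have o x : top x = top v2 -> 3 * 2 ^ n.+1 - 1 <= sdist n.+2 u x.
  by move=> xe; apply: (near_corner_opp N); rewrite antipodeK.
have no x : top x != top v2 -> sdist n.+2 u x <= 3 * 2 ^ n.+1 - 2.
  by move=> xe; apply: (near_corner_notopp N); rewrite antipodeK.
have := o v2 erefl; have := o w2 (esym e); rewrite expnS.
case: (eqVneq (top v1) (top v2)) => [->|/no];
  case: (eqVneq (top w1) (top v2)) => [->|/no]; rewrite ?expnS //; lia.
Qed.

(** The end v1 of an edge between copies is a corner at distance 2 ^ n.+1 - 1
    from the landmark of its copy, and all words outside that copy are farther
    away. *)
Lemma bridge_copy v1 w1 v2 w2 : same_mdist n.+2 z X v1 w1 v2 w2 ->
  c4 (top v1) (top w1) -> agree_below n.+1 v1 (constw (top w1)) ->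
  top v1 = top v2 \/ top v1 = top w2.
Proof.
move=> H e1 b1; case: (eqVneq (top v1) (top v2)) => [|n1]; first by left.
case: (eqVneq (top v1) (top w2)) => [|n2]; first by right.
have [u [Xu uz N]] := landmark (top v1); have := H u Xu uz; rewrite /mdist.
have : sdist n.+2 u v1 = 2 ^ n.+1 - 1.
  rewrite sdist_same ?(near_corner_top N) // (sdist_congr _ b1).
  by rewrite (near_corner_gate (near_corner_pred N)).
have := @near_corner_other _ _ _ v2 N; rewrite eq_sym => /(_ n1).
have := @near_corner_other _ _ _ w2 N; rewrite eq_sym => /(_ n2).
by have := pow2_gt0 n; rewrite expnS; lia.
Qed.

Lemma bridge_end x y x' y' : agree_from n.+2 x z -> agree_from n.+2 x' z ->
  agree_below n.+1 x (constw (top y)) -> agree_below n.+1 x' (constw (top y')) ->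
  top x = top x' -> top y = top y' -> x = x'.
Proof.
move=> xz xz' bx bx' ex ey; apply: word_ext => i ir.
case: (ltngtP i n.+1) => [h|h|->] //; last by rewrite xz ?xz' ?h.
by rewrite bx // bx' // ey.
Qed.

(** The landmarks available inside the copy of v: the elements of X there, and
    the corners through which this copy is left. *)
Definition with_gates v u := X u \/
  (agree_from n.+2 u z /\ exists2 j, c4 (top v) j & agree_below n.+1 u (constw j)).

(** A twin inside the copy that is no twin one level higher is a corner, or the
    mirror of a corner, at an edge leaving the copy. *)
Lemma with_gates_hits v : agree_from n.+2 v z -> hits_from n.+1 v (with_gates v).
Proof.
move=> vz x xv fx.
have xz : agree_from n.+2 x z by apply: agree_fromT (agree_fromS xv) vz.
have tx : top x = top v by apply: xv; rewrite leqnn.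
case: (boolP (is_twin n.+2 x)) => [/(hX xz) [|]|nf]; [by left; left|by right; left|].
have [cx bx] : c4 (top x) (digit x 0) /\
    forall i, 0 < i < n.+1 -> digit x i = digit x 1.
  move: nf; rewrite negb_forall => /existsP[t]; rewrite !negb_imply andbT.
  case/and3P=> t0 /forallP h h'.
  have hh i : 0 < i < t -> digit x i = digit x 1.
    by case/andP=> i0 it; have /implyP/(_ i0)/eqP := h (Ordinal it).
  case: (ltngtP t n.+1) => [tn|tn|tn]; last by rewrite /top -tn.
    by move: h'; rewrite (negPf (is_twinP _ _ fx t _ hh)) // t0.
  by have := ltn_ord t; rewrite ltnS leqNgt tn.
have [j [cj x0 bj]] : exists j, [/\ c4 (top v) j,
    digit x 0 = j \/ digit x 0 = antipode j &
    forall i, 0 < i < n.+1 -> digit x i = j].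
  rewrite -tx; case: (posnP n) => [n0|n0].
    (* a copy with a single digit: its corners are all its words *)
    by exists (digit x 0); split=> //; [left|case=> // i; rewrite n0].
  have h1 := is_twinP _ _ fx 1 n0.
  have {}h1 : ~~ c4 (digit x 1) (digit x 0) by apply: h1; case.
  have : odd (digit x 1) = odd (digit x 0) by move: h1; rewrite c4E negbK => /eqP.
  move/odd_eq=> e1; exists (digit x 1); split=> //.
  by move: cx; case: e1 => ->; rewrite ?c4_antipoder.
have gate y : agree_from n.+2 y z -> digit y 0 = j ->
    (forall i, 0 < i < n.+1 -> digit y i = j) -> with_gates v y.
  move=> yz y0 hy; right; split=> //; exists j => // -[|i] ii.
    by rewrite digit_constw.
  by rewrite digit_constw; apply: hy; rewrite ii.
case: x0 => x0; [left|right]; apply: gate => //.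
- exact: mirror_agree_from.
- by rewrite digit_mirror0 x0 antipodeK.
move=> i /andP[i0 ii]; rewrite digit_mirror ?bj ?i0 //=.
exact: ltn_trans ii _.
Qed.

(** A corner towards copy j behaves like the landmark of copy j: their distances
    to the words of the copy of v differ by the constant 2 ^ n.+1. *)
Lemma with_gates_mdist v w v' w' : agree_from n.+2 v z -> agree_from n.+2 w z ->
  agree_from n.+2 v' z -> agree_from n.+2 w' z ->
  top w = top v -> top v' = top v -> top w' = top v ->
  same_mdist n.+2 z X v w v' w' ->
  same_mdist n.+1 v (with_gates v) v w v' w'.
Proof.
move=> vz wz vz' wz' ew ev' ew' E u Yu uv.
have low x : agree_from n.+2 x z -> top x = top v ->
    sdist n.+2 u x = sdist n.+1 u x.
  by move=> xz tx; apply: sdist_same; rewrite -/(top x) tx uv ?leqnn.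
case: Yu => [Xu|[uz [j cj bu]]].
  have := E u Xu (agree_fromT (agree_fromS uv) vz).
  by rewrite /mdist !low.
have [l [Xl lz N]] := landmark j; have := E l Xl lz.
have far x : top x = top v -> sdist n.+2 l x = 2 ^ n.+1 + sdist n.+1 u x.
  move=> tx; rewrite (near_corner_adj N) -/(top x) ?tx 1?c4_sym //.
  by rewrite (sdist_congl _ bu) sdistC.
by rewrite /mdist !far //; lia.
Qed.

End InductionStep.

(** The hypothesis (v == w) = (v' == w') compares vertices with vertices and
    edges with edges only. *)
Theorem resolve n z X v w v' w' : 0 < n <= r -> hits_from n z X ->
  agree_from n v z -> agree_from n w z ->
  agree_from n v' z -> agree_from n w' z ->
  cell v w -> cell v' w' -> (v == w) = (v' == w') ->
  same_mdist n z X v w v' w' -> [set v; w] = [set v'; w'].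
Proof.
elim: n z X => // -[_ z X _|n IH z X /andP[_ nr]] hX vz wz vz' wz' c c' k E.
  exact: (@resolve1 z X).
pose top x := digit x n.+1.
have cv : agree_from n.+2 v w := agree_fromT vz (agree_fromC wz).
have cv' : agree_from n.+2 v' w' := agree_fromT vz' (agree_fromC wz').
have E' : same_mdist n.+2 z X v' w' v w by move=> u Xu uz; apply/esym/E.
have [e|[e bv bw]] := cell_top nr cv c; last first.
  have [e'|[e' bv' bw']] := cell_top nr cv' c'.
    have [a b] := separate_copies nr hX E e'.
    by move: e; rewrite a b cycle4_adj_irr.
  have m1 := bridge_copy nr hX E e bv.
  have Ec : same_mdist n.+2 z X w v v' w'.
    by move=> u Xu uz; rewrite /mdist minnC; apply: E.
  have := bridge_copy nr hX Ec; rewrite c4_sym => /(_ e bw) m2.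
  have nvw := c4_irr e.
  case: m1 m2 => m1 [] m2; rewrite ?m1 ?m2 ?eqxx // in nvw.
    by rewrite (bridge_end vz vz' bv bv') // (bridge_end wz wz' bw bw').
  by rewrite (bridge_end vz wz' bv bw') // (bridge_end wz vz' bw bv') // setUC.
have [a b] := separate_copies nr hX E' e.
have av x : agree_from n.+2 x z -> top x = top v -> agree_from n.+1 x v.
  move=> xz xv; apply: agree_from_pred => //; exact: agree_fromT (agree_fromC vz).
apply: (IH v (with_gates n z X v)) => //; try exact: av.
- exact: (ltnW nr).
- exact: with_gates_hits.
exact: (with_gates_mdist nr hX).
Qed.

End Sierpinski.

(** * The number of pairs of twins *)

Section Count.

(** The words in which digit 0 is the image under f of digit 1 are exactly the
    words [push f q] ([push_tail]), hence as many as the words q. *)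
Definition push n (f : 'I_4 -> 'I_4) (q : {ffun 'I_n.+1 -> C4}) :
    {ffun 'I_n.+2 -> C4} :=
  [ffun i => if unlift ord0 i is Some j then q j else f (q ord0)].

Lemma digit_push0 n f (q : {ffun 'I_n.+1 -> C4}) :
  digit (push f q) 0 = f (digit q 0).
Proof.
rewrite /digit /push ffunE.
have -> : inord 0 = ord0 :> 'I_n.+2 by apply/val_inj; rewrite /= inordK.
by rewrite unlift_none; congr (f (q _)); apply/val_inj; rewrite /= inordK.
Qed.

Lemma digit_push n f (q : {ffun 'I_n.+1 -> C4}) k : k < n.+1 ->
  digit (push f q) k.+1 = digit q k.
Proof.
move=> kn; rewrite /digit /push ffunE.
have -> : inord k.+1 = lift ord0 (inord k) :> 'I_n.+2.
  by apply/val_inj; rewrite /= inordK ?inordK.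
by rewrite liftK.
Qed.

Lemma push_inj n f : injective (@push n f).
Proof.
move=> p q e; apply: word_ext => k kn.
by rewrite -(digit_push f) // e digit_push.
Qed.

Lemma push_tail n f (x : {ffun 'I_n.+2 -> C4}) :
  digit x 0 = f (digit x 1) -> exists q, x = push f q.
Proof.
move=> e; exists [ffun j => x (lift ord0 j)].
set q := finfun _; have dq k : k < n.+1 -> digit q k = digit x k.+1.
  move=> kn; rewrite /digit /q ffunE; congr (x _); apply/val_inj.
  by rewrite /= !inordK.
by apply: word_ext => -[|k] kn; rewrite ?digit_push0 ?digit_push ?dq.
Qed.

(** Digits 0 and 1 of a twin are equal or antipodal, so equality picks one
    element of each pair. *)
Definition reps m :=
  [set x : {ffun 'I_m.+1 -> C4} | is_twin m.+1 x & digit x 0 == digit x 1].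

Lemma reps1 : reps 1 = push id @: [set: {ffun 'I_1 -> C4}].
Proof.
apply/setP=> x; rewrite inE; apply/andP/imsetP.
  by case=> _ /eqP /(@push_tail _ id) [q ->]; exists q.
case=> q _ ->; rewrite digit_push0 digit_push // eqxx; split=> //.
apply/is_twinP=> t /andP[t0]; rewrite ltnS => t1 _; have -> : t = 1 by lia.
by rewrite digit_push0 digit_push // cycle4_adj_irr.
Qed.

(** Let p be a word with lowest digits p_0, p_1, and x = push id p.  The digits
    of x that matter are a copy of those of p when p_0 = p_1.  If p_0 and p_1
    are antipodal, no edge of positive level leaves x or its mirror: at level 2
    the digits are not adjacent, and higher levels need equal lower digits. *)
Lemma repsS m : reps m.+2 =
  push id @: (reps m.+1 :|: push antipode @: [set: {ffun 'I_m.+1 -> C4}]).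
Proof.
apply/setP=> x; rewrite inE; apply/andP/imsetP => [[/is_twinP fx /eqP e]|[p ph ->]].
  have [p xp] := @push_tail _ id x e; exists p => //; subst x.
  have := fx 2 isT; rewrite !digit_push // digit_push0 => h.
  have {h} : ~~ c4 (digit p 1) (digit p 0).
    by apply: h => -[|[|i]] //; rewrite digit_push.
  rewrite c4E negbK => /eqP/odd_eq [e1|/push_tail[q ->]]; last first.
    by rewrite inE; apply/orP; right; apply: imset_f; rewrite inE.
  rewrite !inE e1 eqxx andbT; apply/orP; left; apply/is_twinP=> t /andP[t0 tm] h.
  rewrite e1; have := fx t.+1; rewrite [digit _ t.+1]digit_push // digit_push0 e1.
  apply=> // -[|[|i]] //.
  rewrite andTb ltnS => it; rewrite !digit_push // ?e1; last exact: ltn_trans it tm.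
  by rewrite h.
rewrite digit_push0 digit_push //; split=> //; apply/is_twinP=> -[|[|t]] //.
  by rewrite digit_push0 digit_push // cycle4_adj_irr.
rewrite andTb ltnS => tm.
rewrite [digit _ t.+2]digit_push // digit_push0 [digit _ 1]digit_push // => h.
move: ph; rewrite !inE => /orP[/andP[/is_twinP fp /eqP e]|/imsetP[q _ e]].
  apply: fp => // i /andP[i0 it]; have := h i.+1.
  by rewrite !digit_push ?e //; [apply|lia].
have e1 : digit p 0 = antipode (digit p 1) by rewrite e digit_push0 digit_push.
case: t tm h => [|t] tm h; first by rewrite e1 c4_antipoder cycle4_adj_irr.
have := h 2 isT; rewrite !digit_push // e1 => /esym/eqP.
by rewrite antipode_neq.
Qed.

Lemma card_reps m : 3 * #|reps m.+1| = 8 + 4 ^ m.+1.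
Proof.
have cw n : #|[set: {ffun 'I_n -> C4}]| = 4 ^ n.
  by rewrite cardsT card_ffun !card_ord.
elim: m => [|m IH].
  by rewrite reps1 card_imset ?cw //; apply: push_inj.
rewrite repsS card_imset; last exact: push_inj.
rewrite cardsU disjoint_setI0; last first.
  apply/pred0P=> x /=; apply/negP=> /andP[].
  rewrite inE => /andP[_ /eqP e] /imsetP[q _ xq].
  have := antipode_neq (digit q 0).
  by rewrite -(digit_push0 antipode) -xq e xq digit_push // eqxx.
rewrite cards0 subn0 card_imset; last exact: push_inj.
rewrite cw [in RHS]expnS; lia.
Qed.

End Count.

(** * The four dimensions *)

Section Dimensions.
Variable m : nat.
Local Notation r := m.+2.
Local Notation G := (sierpinski C4 r).
Implicit Types (x y u v w : G) (F S : {set G}).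

Definition hits F := forall x, is_twin r x -> (x \in F) || (mirror x \in F).

Lemma hits_resolve F v w v' w' : hits F ->
  v = w \/ adj v w -> v' = w' \/ adj v' w' -> (v == w) = (v' == w') ->
  (forall u, u \in F -> edist u v w = edist u v' w') ->
  [set v; w] = [set v'; w'].
Proof.
move=> hF c c' k E.
have full x y : agree_from r x y by move=> i /andP[ri]; rewrite ltnNge ri.
have cl x y : x = y \/ adj x y -> cell x y by case=> [|/adjP]; [left|right].
apply: (@resolve m.+1 r v (fun u => u \in F)) => //; try exact: cl.
- by rewrite leqnn.
- by move=> x _ fx; apply/orP/hF.
by move=> u uF _; have := E u uF; rewrite /edist !distE.
Qed.

Lemma hits_metric F : hits F -> metric_gen F.
Proof.
move=> hF; apply/forallP=> x; apply/forallP=> y; apply/implyP; apply: contraR.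
rewrite negb_exists => /forallP H.
suff : [set x; x] = [set y; y] by rewrite !setUid => /set1_inj ->.
apply: hits_resolve hF _ _ _ _; rewrite ?eqxx //; try by left.
by move=> u uF; have := H u; rewrite uF negbK /edist => /eqP ->.
Qed.

Lemma hits_edge F : hits F -> edge_metric_gen F.
Proof.
move=> hF; apply/forallP=> v; apply/forallP=> w.
apply/forallP=> v'; apply/forallP=> w'.
apply/implyP=> /and3P[e e' ne]; apply: contraR ne.
rewrite negb_exists => /forallP H.
have nA x y : adj x y -> (x == y) = false.
  by case: eqVneq => // ->; rewrite adj_irr.
apply/eqP/(hits_resolve hF); rewrite ?(nA _ _ e) ?(nA _ _ e') //; try by right.
by move=> u uF; have := H u; rewrite uF negbK => /eqP.
Qed.

Lemma metric_hits F : metric_gen F -> hits F.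
Proof. by move=> mF x /is_twin_twins tw; exact: metric_gen_twins tw mF. Qed.

Lemma edge_hits F : edge_metric_gen F -> hits F.
Proof.
move=> mF x /is_twin_twins tw; have [v vx] := has_neighbor x.
exact: edge_metric_gen_twins tw vx mF.
Qed.

Definition twin_set : {set G} := [set x | is_twin r x].
Definition twin_reps : {set G} := reps m.+1.

Lemma mirror_notin_reps x : x \in twin_reps -> mirror x \notin twin_reps.
Proof.
rewrite !inE => /andP[_ /eqP e]; rewrite digit_mirror0 digit_mirror // e.
by rewrite antipode_neq andbF.
Qed.

Lemma hits_reps : hits twin_reps.
Proof.
move=> x fx; rewrite !inE is_twin_mirror // fx digit_mirror0 digit_mirror //=.
have := is_twinP _ _ fx 1 isT; rewrite c4E => /(_ _) h.
have : odd (digit x 0) = odd (digit x 1).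
  by apply/eqP; rewrite eq_sym -[_ == _]negbK; apply: h => -[].
by case/odd_eq => ->; rewrite ?eqxx ?antipodeK ?eqxx ?orbT.
Qed.

(** Each element of F is sent to the representative of its pair. *)
Lemma hits_card F : hits F -> #|twin_reps| <= #|F|.
Proof.
move=> hF; pose g x : G := if x \in twin_reps then x else mirror x.
apply: leq_trans (leq_imset_card g F); apply/subset_leq_card/subsetP=> x xT.
have fx : is_twin r x by move: xT; rewrite inE => /andP[].
case/orP: (hF x fx) => h; apply/imsetP.
  by exists x => //; rewrite /g xT.
by exists (mirror x) => //; rewrite /g (negPf (mirror_notin_reps xT)) mirrorK.
Qed.

Lemma card_twin_set : #|twin_set| = 2 * #|twin_reps|.
Proof.
have -> : twin_set = twin_reps :|: (@mirror m.+1) @: twin_reps.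
  apply/setP=> x; rewrite inE; apply/idP/setUP => [/hits_reps /orP[]|[]].
  - by left.
  - by right; apply/imsetP; exists (mirror x); rewrite ?mirrorK.
  - by rewrite inE => /andP[].
  by case/imsetP=> y; rewrite inE => /andP[fy _] ->; rewrite is_twin_mirror.
rewrite cardsU disjoint_setI0; last first.
  apply/pred0P=> x /=; apply/negP=> /andP[xT /imsetP[y yT e]].
  by have := mirror_notin_reps yT; rewrite -e xT.
rewrite cards0 subn0 card_imset; last exact: inv_inj (@mirrorK _).
by rewrite mul2n addnn.
Qed.

Lemma hits_setT : hits setT.
Proof. by move=> x _; rewrite inE. Qed.

Lemma hits_twin_setD1 u : hits (twin_set :\ u).
Proof.
move=> x fx; rewrite !inE is_twin_mirror // fx !andbT.
case: (eqVneq x u) => [<-|] //=.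
by have [] := is_twin_twins fx; rewrite eq_sym.
Qed.

(** P is the property of being a generator, for vertices or for edges. *)
Variable P : pred {set G}.
Hypotheses (Phits : forall F, P F -> hits F) (hitsP : forall F, hits F -> P F).

Lemma min_card_hits : min_card P = #|twin_reps|.
Proof.
apply: min_card_eq; first exact/hitsP/hits_setT.
  by exists twin_reps => //; apply/hitsP/hits_reps.
by move=> F /Phits/hits_card.
Qed.

(** If F lacked an element of a pair, the deletion of the other one would leave
    the pair unmet. *)
Lemma twin_set_sub_ft F : fault_tolerant P F -> twin_set \subset F.
Proof.
case/andP=> /Phits hF /forall_inP H; apply/subsetP=> x; rewrite inE => fx.
case/orP: (hF x fx) => // tF; have /Phits/(_ x fx) := H _ tF.
by rewrite !inE eqxx orbF => /andP[].
Qed.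

Lemma min_card_ft : min_card (fault_tolerant P) = 2 * #|twin_reps|.
Proof.
rewrite -card_twin_set; apply: min_card_eq.
- apply/andP; split; first exact/hitsP/hits_setT.
  apply/forall_inP=> u _; apply: hitsP => x /(hits_twin_setD1 u).
  by rewrite !inE => /orP[]/andP[-> _]; rewrite ?orbT.
- exists twin_set => //; apply/andP; split.
    by apply: hitsP => x fx; rewrite inE fx.
  by apply/forall_inP=> u _; apply/hitsP/hits_twin_setD1.
by move=> F /twin_set_sub_ft/subset_leq_card.
Qed.

End Dimensions.

Import GRing.Theory.
Local Open Scope ring_scope.

Theorem theorem4p1 (r : nat) (hr : (2 <= r)%N) :
  let S := sierpinski C4 r in
  (mdim S = edim S /\
   (edim S)%:R = 4%:R / 3%:R * (2%:R + 4%:R ^+ (r - 2)) :> rat) /\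
  (ft_mdim S = ft_edim S /\
   (ft_edim S)%:R = 8%:R / 3%:R * (2%:R + 4%:R ^+ (r - 2)) :> rat).
Proof.
case: r hr => [|[|m]] // _ S.
have M := @metric_hits m; have M' := @hits_metric m.
have E := @edge_hits m; have E' := @hits_edge m.
rewrite /mdim /edim /ft_mdim /ft_edim.
rewrite !(min_card_hits M M') !(min_card_hits E E').
rewrite !(min_card_ft M M') !(min_card_ft E E').
have n3 : 3%:R != 0 :> rat by [].
have c : 3%:R * #|twin_reps m|%:R = 4%:R * (2%:R + 4%:R ^+ m) :> rat.
  rewrite -natrX -natrD -!natrM; congr _%:R.
  by rewrite /twin_reps card_reps expnS; lia.
rewrite !subSS subn0; split; split=> //; apply: (mulfI n3).
  by rewrite c mulrA mulrCA divff // mulr1.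
by rewrite natrM mulrCA c mulrA [RHS]mulrA [3%:R * _]mulrCA divff // mulr1 -natrM.
Qed.
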